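(* Let $P_1$ and $P_2$ be two finite sets of points in $\mathbb{R}^2$ with $|P_1| = n$ and $|P_2| = m$, such that all points of $P_1$ lie on a line $\ell_1$, all points of $P_2$ lie on a line $\ell_2$, and the lines $\ell_1$ and $\ell_2$ are neither parallel nor orthogonal. Let $D(P_1,P_2) = \left|\{\operatorname{dist}(p,q) : p \in P_1,\ q \in P_2\}\right|$ be the number of distinct Euclidean distances between points of $P_1$ and points of $P_2$. Then \[ D(P_1,P_2) = \Omega\left(\min\left\{n^{2/3}m^{2/3},\, n^2,\, m^2\right\}\right), \] where the implied constant is absolute (independent of $n$, $m$, the point sets and the lines). *)

(* Defs.v *)
From HB Require Import structures.
From mathcomp Require Import all_boot all_order all_algebra.
From mathcomp Require Import finmap.
From mathcomp Require Import all_classical all_reals all_analysis.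

Set Implicit Arguments.
Unset Strict Implicit.
Unset Printing Implicit Defensive.

Import Order.TTheory GRing.Theory Num.Theory.
Import numFieldNormedType.Exports.
Local Open Scope ring_scope.

(* The canonical norm of R * R in the library is the max norm, so the
   Euclidean distance is defined explicitly. *)
Definition edist (R : realType) (p q : R * R) : R :=
  Num.sqrt ((p.1 - q.1) ^+ 2 + (p.2 - q.2) ^+ 2).

Record line (R : realType) := Line {
  line_pt : R * R;
  line_dir : R * R;
  line_dir_neq0 : line_dir != 0
}.

Definition on_line (R : realType) (l : line R) (p : R * R) : Prop :=
  exists t : R, p = line_pt l + t *: line_dir l.

(* Coinciding lines count as parallel. *)
Definition parallel (R : realType) (l1 l2 : line R) : Prop :=
  exists k : R, line_dir l2 = k *: line_dir l1.

Definition orthogonal_lines (R : realType) (l1 l2 : line R) : Prop :=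
  (line_dir l1).1 * (line_dir l2).1 + (line_dir l1).2 * (line_dir l2).2 = 0.

Definition distances (R : realType) (P1 P2 : {fset R * R}) : {fset R} :=
  [fset edist p q | p in P1, q in P2]%fset.

Definition num_distances (R : realType) (P1 P2 : {fset R * R}) : nat :=
  #|` distances P1 P2|.

(* Main.v *)
(* Let [o] be the meeting point of the lines, [x], [y] the coordinates along
   them from [o], so that the squared distance is
   [F x y = A x^2 + B y^2 - 2 C x y] with [C <> 0] and [C^2 < A B]. By
   Cauchy-Schwarz, [(n m)^2 <= D E], where [E] counts the quadruples with
   [F x y = F x' y']. View [E] as the number of incidences between the [n^2]
   points [(x, x')] and the [m^2] hyperbolas indexed by [(y, y')]. Because the
   points form a Cartesian product, the Szemeredi-Trotter bound for them needs no
   crossing lemma: cut the grid into boxes of [k] by [k] consecutive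
   coordinates. A hyperbola consists of four monotone arcs, so it meets [O(n/k)]
   boxes, and two points off the diagonals [x' = x], [x' = -x] lie on at most two
   hyperbolas; hence [E = O(m^2 n / k + n^2 k^2 + n m)]. If [mu] is the minimum in
   the theorem, then [mu^3 <= n^2 m^2], and [k] close to [mu / n] makes each term
   [O(n^2 m^2 / mu)]. *)
Require Import Defs.
From HB Require Import structures.
From mathcomp Require Import all_boot all_order all_algebra.
From mathcomp Require Import finmap zify ring lra.

Set Implicit Arguments.
Unset Strict Implicit.
Unset Printing Implicit Defensive.

Import Order.TTheory GRing.Theory Num.Theory.

(** * Double counting: Cauchy-Schwarz and incidences *)

(** Cauchy-Schwarz for the fiber sizes, obtained within [nat] by summing [2 a b <= a ^ 2 + b ^ 2]
    over all pairs of values. *)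
Lemma card_sqr_fibers (T V : finType) (g : T -> V) :
  #|T| ^ 2 <= #|V| * #|[set tt : T * T | g tt.1 == g tt.2]|.
Proof.
pose f v := #|[set t | g t == v]|.
have sf : \sum_v f v = #|T|.
  rewrite -sum1_card (partition_big g predT) //=.
  by apply: eq_bigr => v _; rewrite sum1dep_card.
have sf2 : \sum_v f v ^ 2 = #|[set tt : T * T | g tt.1 == g tt.2]|.
  rewrite -sum1dep_card (partition_big (fun tt => g tt.1) predT) //=.
  apply: eq_bigr => v _; rewrite sum1dep_card -mulnn -cardsX; apply: eq_card.
  move=> [t u]; rewrite !inE /= [RHS]andbC.
  by case: (eqVneq (g t) v) => [->|] //=; rewrite eq_sym.
rewrite -sf2 -(leq_pmul2l (isT : 0 < 2)) -sf -mulnn big_distrlr /= big_distrr /=.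
apply: (@leq_trans (\sum_u \sum_v (f u ^ 2 + f v ^ 2))).
  apply: leq_sum => u _; rewrite big_distrr /=; apply: leq_sum => v _.
  exact: nat_Cauchy.
rewrite (eq_bigr (fun u => #|V| * f u ^ 2 + \sum_v f v ^ 2)); last first.
  by move=> u _; rewrite big_split /= sum_nat_const.
by rewrite big_split /= sum_nat_const -big_distrr /= mul2n addnn.
Qed.

(* A fiber with [t >= 1] elements has at most [1 + t (t - 1)] of them. *)
Lemma card_le_imset_pairs (T L : finType) (b : T -> L) (S : {set T}) :
  #|S| <= #|b @: S| +
    #|[set pq : T * T | [&& pq.1 \in S, pq.2 \in S, pq.1 != pq.2
                          & b pq.1 == b pq.2]]|.
Proof.
pose rep p := odflt p [pick q in S | b q == b p].
have repP p : p \in S -> (rep p \in S) * (b (rep p) == b p).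
  move=> pS; rewrite /rep; case: pickP => [q /andP[] //|/(_ p)].
  by rewrite pS eqxx.
have repE p q : p \in S -> q \in S -> b p = b q -> rep p = rep q.
  move=> pS qS e; rewrite /rep e; case: pickP => // /(_ q).
  by rewrite qS eqxx.
(* [b] is injective on the representatives, and any other [p] is recorded by the pair
   [(p, rep p)]. *)
rewrite -(cardsID [set p | rep p == p] S) leq_add //.
  rewrite -(@card_in_imset _ _ b (S :&: [set p | rep p == p])).
    by apply: subset_leq_card; apply: imsetS; apply: subsetIl.
  move=> p q; rewrite !inE => /andP[pS /eqP ep] /andP[qS /eqP eq] e.
  by rewrite -ep -eq; apply: repE.
rewrite -(@card_imset _ _ (fun p => (p, rep p))); last by move=> p q [].
apply: subset_leq_card; apply/subsetP => _ /imsetP[p + ->].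
rewrite !inE => /andP[pr pS] /=; rewrite pS !repP //= eq_sym pr /=.
by rewrite eq_sym repP.
Qed.

(** Bound the points on each curve by the labels it meets plus its ordered pairs of distinct points
    with equal labels. Summed over the curves, each such pair is charged at most twice. *)
Lemma incidence_bound (P G L : finType) (inc : P -> G -> bool) (b : P -> L)
    (M : nat) :
  (forall g, #|b @: [set p | inc p g]| <= M) ->
  (forall p q, p != q -> #|[set g | inc p g && inc q g]| <= 2) ->
  #|[set pg : P * G | inc pg.1 pg.2]| <=
    #|G| * M + 2 * #|[set pq : P * P | b pq.1 == b pq.2]|.
Proof.
move=> hM h2.
rewrite -sum1dep_card (partition_big snd predT) //=.
pose W g (pq : P * P) :=
  [&& inc pq.1 g, inc pq.2 g, pq.1 != pq.2 & b pq.1 == b pq.2].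
apply: (@leq_trans (\sum_g (M + \sum_(pq | W g pq) 1))).
  apply: leq_sum => g _; rewrite !sum1dep_card.
  apply: (@leq_trans #|[set p | inc p g]|).
    rewrite -(@card_imset P _ (fun p => (p, g))); last by move=> p q [].
    apply: subset_leq_card; apply/subsetP => -[p h]; rewrite !inE /=.
    by case/andP=> ph /eqP<-; apply: imset_f; rewrite inE.
  apply: leq_trans (card_le_imset_pairs b _) _; apply: leq_add => //.
  apply: subset_leq_card.
  by apply/subsetP => pq; rewrite !inE.
rewrite big_split /= sum_nat_const leq_add2l.
rewrite (exchange_big_dep (fun pq => (pq.1 != pq.2) && (b pq.1 == b pq.2))) /=;
  last by move=> g pq _ /and4P[_ _ -> ->].
rewrite mulnC -sum_nat_const; 
apply: leq_trans
  (_ : \sum_(pq : P * P | (pq.1 != pq.2) && (b pq.1 == b pq.2)) 2 <= _).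
  apply: leq_sum => -[p q] /= /andP[npq _].
  rewrite sum1dep_card; apply: leq_trans (h2 _ _ npq).
  apply: subset_leq_card; apply/subsetP => g; rewrite !inE.
  by case/and4P=> /= -> ->.
rewrite [leqRHS](eq_bigl (fun pq => b pq.1 == b pq.2)); last first.
  by move=> ?; rewrite inE.
rewrite [leqRHS](bigID (fun pq : P * P => pq.1 != pq.2)) /=.
rewrite (eq_bigl (fun pq => (b pq.1 == b pq.2) && (pq.1 != pq.2))).
  exact: leq_addr.
by move=> pq; rewrite andbC.
Qed.

(** * Monotone paths through a grid of cells *)

Lemma card_chain (T : finType) (r : nat) (a b : T -> 'I_r) (S : {set T}) :
  {in S &, forall p q, a p < a q -> b p <= b q} ->
  #|[set (a p, b p) | p in S]| <= 2 * r.
Proof.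
move=> mono.
(* [u + v] is injective on the visited cells, which form a chain. *)
have hg (u : 'I_r * 'I_r) : u.1 + u.2 < 2 * r by case: u => [[i ?] [j ?]] /=; lia.
rewrite -(@card_in_imset _ _ (fun u => Ordinal (hg u))).
  by rewrite -[leqRHS]card_ord max_card.
move=> _ _ /imsetP[p pS ->] /imsetP[q qS ->] [] e.
have := mono _ _ pS qS; have := mono _ _ qS pS => h1 h2.
have ea : a p = a q by apply: val_inj; move=> /=; lia.
by congr pair => //; apply: val_inj => /=; move: e; rewrite ea => /=; lia.
Qed.

Lemma card_antichain (T : finType) (r : nat) (a b : T -> 'I_r) (S : {set T}) :
  {in S &, forall p q, a p < a q -> b q <= b p} ->
  #|[set (a p, b p) | p in S]| <= 2 * r.
Proof.
move=> anti.
have := @card_chain _ r a (fun p => rev_ord (b p)) S.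
rewrite -(@card_imset _ _ (fun u : 'I_r * 'I_r => (u.1, rev_ord u.2))); last first.
  by move=> [u v] [u' v'] [-> e]; congr pair; apply: rev_ord_inj; apply: val_inj.
rewrite -imset_comp (@eq_imset _ _ _ (fun p => (a p, b p))) => [|p /=];
  last by rewrite rev_ordK.
apply => p q pS qS h /=.
by have := anti _ _ pS qS h; lia.
Qed.

Lemma card_divn_eq (n k q : nat) : 0 < k -> #|[set j : 'I_n | j %/ k == q]| <= k.
Proof.
move=> k0; have h (j : 'I_n) : j %% k < k by rewrite ltn_mod.
rewrite -(@card_in_imset _ _ (fun j => Ordinal (h j))).
  by rewrite -[leqRHS]card_ord max_card.
move=> i j; rewrite !inE => /eqP ei /eqP ej [] e; apply: val_inj => /=.
by rewrite (divn_eq i k) (divn_eq j k) ei ej e.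
Qed.

(** * Intersections of hyperbolas with lines *)

Local Open Scope ring_scope.

(* Two points of the line on the conic give a linear condition on the sum of
   their abscissae; a third point forces slope [+-1] through the center. *)
Lemma hyperbola_chord (R : realFieldType) (e f d s g u1 u2 u3 : R) :
  u1 != u2 -> u1 != u3 -> u2 != u3 ->
  (u1 - e) ^+ 2 - (s * u1 + g - f) ^+ 2 = d ->
  (u2 - e) ^+ 2 - (s * u2 + g - f) ^+ 2 = d ->
  (u3 - e) ^+ 2 - (s * u3 + g - f) ^+ 2 = d ->
  d = 0.
Proof.
move=> n12 n13 n23 h1 h2 h3.
(* Restricted to the line, the conic is a polynomial in [u] with leading coefficient [1 - s ^+ 2]
   and linear coefficient [2 * b]. *)
pose b := - e - s * (g - f).
have quot u v : u != v -> (u - e) ^+ 2 - (s * u + g - f) ^+ 2 = d ->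
    (v - e) ^+ 2 - (s * v + g - f) ^+ 2 = d ->
    (1 - s ^+ 2) * (u + v) + 2 * b = 0.
  move=> nuv hu hv; apply: (mulfI (x := u - v)); first by rewrite subr_eq0.
  rewrite mulr0; transitivity (((u - e) ^+ 2 - (s * u + g - f) ^+ 2) -
    ((v - e) ^+ 2 - (s * v + g - f) ^+ 2)); first by rewrite /b; ring.
  by rewrite hu hv subrr.
have q12 := quot _ _ n12 h1 h2; have q13 := quot _ _ n13 h1 h3.
have s2 : s ^+ 2 = 1.
  apply/eqP; rewrite eq_sym -subr_eq0; apply/eqP.
  apply: (mulIf (x := u2 - u3)); first by rewrite subr_eq0.
  rewrite mul0r; transitivity (((1 - s ^+ 2) * (u1 + u2) + 2 * b) -
    ((1 - s ^+ 2) * (u1 + u3) + 2 * b)); first by ring.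
  by rewrite q12 q13 subrr.
have b0 : b = 0 by move: q12; rewrite s2; lra.
have eE : e = - s * (g - f) by move: b0; rewrite /b; lra.
rewrite -h1 eE; transitivity ((1 - s ^+ 2) * (u1 ^+ 2 - (g - f) ^+ 2)).
  by ring.
by rewrite s2 subrr mul0r.
Qed.

(** The line is a graph over the first axis, or over the second when [be = 0]; either way
    [hyperbola_chord] applies. *)
Lemma hyperbola_line (R : realFieldType) (e f d al be g : R) (z1 z2 z3 : R * R) :
  d != 0 -> (al != 0) || (be != 0) ->
  z1 != z2 -> z1 != z3 -> z2 != z3 ->
  (forall z, z \in [:: z1; z2; z3] ->
     (z.1 - e) ^+ 2 - (z.2 - f) ^+ 2 = d /\ al * z.1 - be * z.2 = g) ->
  False.
Proof.
move=> d0 nz n12 n13 n23 hz; move/eqP: d0; apply.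
have [c1 l1] : _ /\ _ := hz z1 ltac:(by rewrite !inE eqxx).
have [c2 l2] : _ /\ _ := hz z2 ltac:(by rewrite !inE eqxx orbT).
have [c3 l3] : _ /\ _ := hz z3 ltac:(by rewrite !inE eqxx !orbT).
case: (eqVneq be 0) nz => [be0|nbe _]; last first.
  have sl z : al * z.1 - be * z.2 = g -> z.2 = al / be * z.1 + - (g / be).
    by move=> <-; field.
  have inj (z w : R * R) : al * z.1 - be * z.2 = g -> al * w.1 - be * w.2 = g ->
      z != w -> z.1 != w.1.
    move=> hz1 hw; apply: contra => /eqP e1; apply/eqP.
    by apply: injective_projections => //; rewrite (sl z) // (sl w) // e1.
  rewrite (sl _ l1) in c1; rewrite (sl _ l2) in c2; rewrite (sl _ l3) in c3.
  exact: (hyperbola_chord (inj _ _ l1 l2 n12) (inj _ _ l1 l3 n13)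
    (inj _ _ l2 l3 n23) c1 c2 c3).
rewrite orbF => nal.
have sl z : al * z.1 - be * z.2 = g -> z.1 = be / al * z.2 + g / al.
  by move=> <-; field.
have inj (z w : R * R) : al * z.1 - be * z.2 = g -> al * w.1 - be * w.2 = g ->
    z != w -> z.2 != w.2.
  move=> hz1 hw; apply: contra => /eqP e1; apply/eqP.
  by apply: injective_projections => //; rewrite (sl z) // (sl w) // e1.
rewrite (sl _ l1) in c1; rewrite (sl _ l2) in c2; rewrite (sl _ l3) in c3.
(* Exchanging the two axes replaces [d] by [- d]. *)
apply: oppr_inj; rewrite oppr0.
apply: (hyperbola_chord (inj _ _ l1 l2 n12) (inj _ _ l1 l3 n13)
    (inj _ _ l2 l3 n23)).
- by rewrite -c1 opprB.
- by rewrite -c2 opprB.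
- by rewrite -c3 opprB.
Qed.

(** This is [|x d1 - y d2|^2] when [A], [B] are the squared norms of [d1], [d2] and [C] is their
    inner product. *)
Definition quad_form (R : nzRingType) (A B C x y : R) : R :=
  A * x ^+ 2 + B * y ^+ 2 - 2 * C * x * y.

(** Each of the two points gives a conic in the plane of [z]. Both have quadratic part
    [B (z.1^2 - z.2^2)], so their difference is a line, nondegenerate because [C != 0] and the
    points differ; the first conic is a proper hyperbola because [x ^+ 2 != x' ^+ 2]. *)
Lemma quad_form_two_points (R : realFieldType) (A B C x x' w w' : R)
    (z1 z2 z3 : R * R) :
  B != 0 -> C != 0 -> C ^+ 2 != A * B -> x ^+ 2 != x' ^+ 2 ->
  (x, x') != (w, w') ->
  z1 != z2 -> z1 != z3 -> z2 != z3 ->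
  (forall z, z \in [:: z1; z2; z3] ->
     quad_form A B C x z.1 = quad_form A B C x' z.2 /\
     quad_form A B C w z.1 = quad_form A B C w' z.2) ->
  False.
Proof.
move=> B0 C0 D0 nx nxw n12 n13 n23 hz.
(* [B F x y = (B y - C x)^2 + (A B - C^2) x^2]. *)
pose sc (z : R * R) := (B * z.1, B * z.2).
have scI : injective sc.
  by move=> [a b] [a' b'] [/(mulfI B0) -> /(mulfI B0) ->].
apply: (@hyperbola_line _ (C * x) (C * x') ((A * B - C ^+ 2) * (x' ^+ 2 - x ^+ 2))
  (2 * C * (x - w)) (2 * C * (x' - w'))
  (B * (A * (x ^+ 2 - w ^+ 2 - x' ^+ 2 + w' ^+ 2))) (sc z1) (sc z2) (sc z3));
  rewrite ?(inj_eq scI) //.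
- by rewrite mulf_neq0 // subr_eq0 eq_sym.
- rewrite !mulf_eq0 pnatr_eq0 (negPf C0) /= !subr_eq0 -negb_and.
  by move: nxw; rewrite xpair_eqE.
- move=> z hz'; have [v vin ->] : exists2 v, v \in [:: z1; z2; z3] & z = sc v.
    by apply/mapP.
  have [] := hz v vin; rewrite /quad_form /= => h1 h2; split.
    apply/eqP; rewrite -subr_eq0; apply/eqP.
    transitivity (B * ((A * x ^+ 2 + B * v.1 ^+ 2 - 2 * C * x * v.1) -
      (A * x' ^+ 2 + B * v.2 ^+ 2 - 2 * C * x' * v.2))); first by ring.
    by rewrite h1; ring.
  apply/eqP; rewrite -subr_eq0; apply/eqP.
  transitivity (B * ((A * w ^+ 2 + B * v.1 ^+ 2 - 2 * C * w * v.1) -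
      (A * w' ^+ 2 + B * v.2 ^+ 2 - 2 * C * w' * v.2) -
    ((A * x ^+ 2 + B * v.1 ^+ 2 - 2 * C * x * v.1) -
      (A * x' ^+ 2 + B * v.2 ^+ 2 - 2 * C * x' * v.2)))); first by ring.
  by rewrite h1 h2; ring.
Qed.

(** * Counting coincidences by boxes *)

Lemma card_imset_split (T L : finType) (f : T -> L) (S X : {set T}) :
  (#|f @: S| <= #|f @: (S :&: X)| + #|f @: (S :\: X)|)%N.
Proof.
rewrite -{1}(setID S X) imsetU; exact: leq_card_setU.
Qed.

(** The signs of [u] and [v] cut the hyperbola into four arcs, increasing where the signs agree and
    decreasing where they differ; each visits at most [2 * r] cells. *)
Lemma card_labels_hyperbola (R : realFieldType) (T : finType) (r : nat)
    (a b : T -> 'I_r) (u v : T -> R) (S : {set T}) (d : R) :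
  {in S &, forall p q, (a p < a q)%N -> u p < u q} ->
  {in S &, forall p q, (b p < b q)%N -> v p < v q} ->
  {in S, forall p, u p ^+ 2 - v p ^+ 2 = d} ->
  (#|[set (a p, b p) | p in S]| <= 8 * r)%N.
Proof.
move=> hu hv hd.
pose U := [set p | 0 <= u p]; pose V := [set p | 0 <= v p].
apply: leq_trans (card_imset_split _ _ U) _.
apply: (@leq_trans ((2 * r + 2 * r) + (2 * r + 2 * r))%N); last by lia.
have key p q : p \in S -> q \in S -> u p ^+ 2 - v p ^+ 2 = u q ^+ 2 - v q ^+ 2.
  by move=> pS qS; rewrite !hd.
apply: leq_add; apply: leq_trans (card_imset_split _ _ V) _; apply: leq_add;
  [apply: card_chain | apply: card_antichain
  | apply: card_antichain | apply: card_chain];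
  move=> p q; rewrite !inE -?ltNge.
- move=> /andP[/andP[pS up] vp] /andP[/andP[qS uq] vq] lab.
  rewrite leqNgt; apply/negP => lab'.
  have := hu _ _ pS qS lab; have := hv _ _ qS pS lab'.
  by have := key _ _ pS qS; nra.
- move=> /and3P[vp pS up] /and3P[vq qS uq] lab.
  rewrite leqNgt; apply/negP => lab'.
  have := hu _ _ pS qS lab; have := hv _ _ pS qS lab'.
  by have := key _ _ pS qS; nra.
- move=> /andP[/andP[up pS] vp] /andP[/andP[uq qS] vq] lab.
  rewrite leqNgt; apply/negP => lab'.
  have := hu _ _ pS qS lab; have := hv _ _ pS qS lab'.
  by have := key _ _ pS qS; nra.
- move=> /and3P[vp up pS] /and3P[vq uq qS] lab.
  rewrite leqNgt; apply/negP => lab'.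
  have := hu _ _ pS qS lab; have := hv _ _ qS pS lab'.
  by have := key _ _ pS qS; nra.
Qed.

Lemma card_same_box (n k : nat) :
  (0 < k)%N ->
  (#|[set pq : ('I_n * 'I_n) * ('I_n * 'I_n) |
      (pq.1.1 %/ k == pq.2.1 %/ k) && (pq.1.2 %/ k == pq.2.2 %/ k)]|
    <= n * n * (k * k))%N.
Proof.
move=> k0; rewrite -sum1dep_card.
rewrite (partition_big fst predT) //=.
apply: (@leq_trans (\sum_(p : 'I_n * 'I_n) k * k)%N); last first.
  by rewrite sum_nat_const card_prod card_ord.
apply: leq_sum => p _; rewrite sum1dep_card.
apply: leq_trans (leq_mul (card_divn_eq n (p.1 %/ k) k0)
  (card_divn_eq n (p.2 %/ k) k0)).
rewrite -cardsX -(@card_imset _ _ (fun q : 'I_n * 'I_n => (p, q)));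
  last by move=> ? ? [].
apply: subset_leq_card; apply/subsetP => -[p' q].
rewrite !inE /= => /andP[/andP[h1 h2] /eqP e].
by rewrite -e; apply: imset_f; rewrite !inE /= eq_sym h1 eq_sym h2.
Qed.

(** A quadruple is grouped as a point [(i, i')] and a hyperbola [(j, j')], not as two pairs
    [(i, j)], [(i', j')]. *)
Definition coincidences (R : nzRingType) (n m : nat) (A B C : R)
    (x : 'I_n -> R) (y : 'I_m -> R) : {set ('I_n * 'I_n) * ('I_m * 'I_m)} :=
  [set pg | quad_form A B C (x pg.1.1) (y pg.2.1)
         == quad_form A B C (x pg.1.2) (y pg.2.2)].

Lemma card_coincidences_diag (R : realFieldType) (n m : nat) (A B C : R)
    (x : 'I_n -> R) (y : 'I_m -> R) :
  B != 0 -> injective x -> injective y ->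
  (#|coincidences A B C x y :&: [set pg | x pg.1.1 ^+ 2 == x pg.1.2 ^+ 2]|
    <= 4 * (n * m))%N.
Proof.
move=> B0 xI yI.
(* Given [x] and [y], the value [x' = +-x] is fixed by its sign, and then
   [(B y' - C x')^2] is known. *)
pose h (pg : ('I_n * 'I_n) * ('I_m * 'I_m)) :=
  ((pg.1.1, pg.2.1), (x pg.1.2 == x pg.1.1,
     C * x pg.1.2 <= B * y pg.2.2)).
rewrite -(@card_in_imset _ _ h); last first.
  move=> [[i i'] [j j']] [[k k'] [l l']]; rewrite !inE /= /quad_form.
  move=> /andP[/eqP q1 s1] /andP[/eqP q2 s2] [ei ej eb e2]; subst k l.
  have ei : i' = k'.
    apply: xI; move: eb s1 s2; rewrite !eqf_sqr ![x i == x _]eq_sym.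
    case: eqVneq => [->|_]; first by move/esym/eqP.
    by move/esym/negPf => -> /= /eqP e1 /eqP e3; rewrite e1 in e3; exact: oppr_inj.
  subst k'; congr (_, (_, _)); apply: yI; apply: (mulfI B0).
  have : (B * y j' - C * x i') ^+ 2 = (B * y l' - C * x i') ^+ 2.
    apply/eqP; rewrite -subr_eq0; apply/eqP.
    transitivity (B * ((A * x i' ^+ 2 + B * y j' ^+ 2 - 2 * C * x i' * y j') -
       (A * x i' ^+ 2 + B * y l' ^+ 2 - 2 * C * x i' * y l'))); first by ring.
    by rewrite -q1 -q2 subrr mulr0.
  (* Opposite square roots are excluded unless both vanish, since the recorded comparison gives them
     the same sign. *)
  move/eqP; rewrite eqf_sqr => /orP[/eqP|/eqP]; first by lra.
  by move: e2; case: (lerP (C * x i') (B * y j')) => + /esym;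
    [|move=> + /negbT; rewrite -ltNge]; lra.
apply: leq_trans (max_card _) _.
by rewrite !card_prod !card_ord card_bool mulnC.
Qed.

Lemma card_coincidences (R : realFieldType) (n m k : nat) (A B C : R)
    (x : 'I_n -> R) (y : 'I_m -> R) :
  (0 < k)%N -> 0 < A -> 0 < B -> C != 0 -> C ^+ 2 < A * B ->
  {homo x : i j / (i < j)%N >-> i < j} -> injective y ->
  (#|coincidences A B C x y| <=
    m * m * (8 * (n.-1 %/ k).+1) + 2 * (n * n * (k * k)) + 4 * (n * m))%N.
Proof.
move=> k0 A0 B0 C0 CAB xm yI.
have xI : injective x.
  move=> i j e; apply: val_inj => /=.
  by case: (ltngtP i j) => // /xm; rewrite e ltxx.
rewrite -(cardsID [set pg | x pg.1.1 ^+ 2 == x pg.1.2 ^+ 2]) addnC.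
apply: leq_add; last by apply: card_coincidences_diag => //; apply: lt0r_neq0.
(* The largest index is [n.-1], so this is the number of blocks of [k] consecutive indices. *)
set r := (_ %/ k).+1.
have lP (i : 'I_n) : (i %/ k < r)%N.
  by rewrite ltnS leq_div2r //; case: i => i /=; lia.
pose l i := Ordinal (lP i).
have lm i j : (l i < l j)%N -> x i < x j.
  by move=> h; apply: xm; rewrite ltnNge; apply: contraL h;
    rewrite -leqNgt /=; apply: leq_div2r.
pose inc (p : 'I_n * 'I_n) (g : 'I_m * 'I_m) :=
  (x p.1 ^+ 2 != x p.2 ^+ 2) &&
  (quad_form A B C (x p.1) (y g.1) == quad_form A B C (x p.2) (y g.2)).
have -> : coincidences A B C x y :\: [set pg | x pg.1.1 ^+ 2 == x pg.1.2 ^+ 2]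
  = [set pg | inc pg.1 pg.2].
  by apply/setP => pg; rewrite !inE.
apply: leq_trans (@incidence_bound _ _ _ inc (fun p => (l p.1, l p.2)) (8 * r) _ _) _.
(* [A F x y = (A x - C y)^2 + (A B - C^2) y^2]. *)
- move=> g; apply: (@card_labels_hyperbola _ _ _ _ _
    (fun p => A * x p.1 - C * y g.1) (fun p => A * x p.2 - C * y g.2) _
    ((A * B - C ^+ 2) * (y g.2 ^+ 2 - y g.1 ^+ 2))).
  + by move=> p q _ _ /lm h; rewrite ltrD2r ltr_pM2l.
  + by move=> p q _ _ /lm h; rewrite ltrD2r ltr_pM2l.
  + move=> p; rewrite inE => /andP[_ /eqP]; rewrite /quad_form => h.
    apply/eqP; rewrite -subr_eq0; apply/eqP.
    transitivity (A * ((A * x p.1 ^+ 2 + B * y g.1 ^+ 2 - 2 * C * x p.1 * y g.1) -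
       (A * x p.2 ^+ 2 + B * y g.2 ^+ 2 - 2 * C * x p.2 * y g.2))); first by ring.
    by rewrite h subrr mulr0.
- move=> p q npq; rewrite leqNgt; apply/negP.
  move=> /card_gt2P[g1 [g2 [g3 [[i1 i2 i3] [n12 n23 n31]]]]].
  have pos : exists2 z : 'I_m * 'I_m, inc p z & inc q z.
    by exists g1; move: i1; rewrite inE => /andP[].
  pose f (g : 'I_m * 'I_m) := (y g.1, y g.2).
  have fI : injective f by move=> [a b] [a' b'] [/yI-> /yI->].
  apply: (@quad_form_two_points _ A B C (x p.1) (x p.2) (x q.1) (x q.2)
    (f g1) (f g2) (f g3)).
  + exact: lt0r_neq0.
  + by [].
  + by rewrite lt_eqF.
  + by case: pos => z /andP[].
  + by apply: contra npq => /eqP[/xI e1 /xI e2]; apply/eqP/injective_projections.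
  + by rewrite (inj_eq fI).
  + by rewrite (inj_eq fI) eq_sym.
  + by rewrite (inj_eq fI).
  + move=> _ /(@mapP _ _ f [:: g1; g2; g3])[g gin ->].
    have : g \in [set g | inc p g && inc q g].
      by move: gin; rewrite !in_cons in_nil orbF => /or3P[] /eqP->.
    by rewrite inE => /andP[/andP[_ /eqP ?] /andP[_ /eqP ?]].
rewrite card_prod card_ord leq_add2l leq_mul2l /=.
apply: leq_trans (card_same_box n k0); apply: subset_leq_card.
by apply/subsetP => pq; rewrite !inE xpair_eqE.
Qed.

(* Imported only here because these libraries shadow the [finset] names, such as
   [subsetP], used above. *)
From mathcomp Require Import all_classical all_reals all_analysis.
Import numFieldNormedType.Exports.

(** * Coordinates along the two lines *)

(** Numbering the points in increasing order along the line turns blocks of indices into intervals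
    of coordinates, as the boxes require. *)
Lemma sorted_line_coordinates (R : realType) (P : {fset R * R}) (l : line R)
    (o : R * R) :
  on_line l o -> (forall p, p \in P -> on_line l p) ->
  exists x : 'I_#|` P| -> R,
    {homo x : i j / (i < j)%N >-> i < j} /\
    forall i, o + x i *: line_dir l \in P.
Proof.
move=> [t0 oE] hP.
have /choice[tau htau] : forall p, exists t, p \in P -> p = o + t *: line_dir l.
  move=> p; case: (boolP (p \in P)) => [/hP[t ->]|]; last by exists 0.
  by exists (t - t0) => _; rewrite oE -addrA -scalerDl (addrC t0) subrK.
pose s := sort <=%R [seq tau p | p <- P].
have ss : size s = #|` P| by rewrite size_sort size_map.
have su : uniq s.
  rewrite sort_uniq map_inj_in_uniq ?fset_uniq // => p q pP qP e.
  by rewrite (htau p) // (htau q) // e.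
have slt : sorted <%R s.
  by rewrite lt_sorted_uniq_le su sort_le_sorted.
exists (fun i => s`_i); split=> [i j ij|i].
  by apply: (sorted_ltn_nth lt_trans) => //; rewrite inE ss.
have : s`_i \in s by rewrite mem_nth // ss.
by rewrite mem_sort => /mapP[p pP ->]; rewrite -htau.
Qed.

Lemma cross_neq0 (R : realType) (l1 l2 : line R) : ~ parallel l1 l2 ->
  (line_dir l1).1 * (line_dir l2).2 - (line_dir l1).2 * (line_dir l2).1 != 0.
Proof.
move=> np; apply/eqP => h; apply: np; rewrite /parallel.
move: h (line_dir_neq0 l1).
case: (line_dir l1) (line_dir l2) => [a b] [c d] /= h nz.
case: (eqVneq a 0) nz => [a0|na _].
  case: (eqVneq b 0) => [b0|nb _]; first by rewrite a0 b0 eqxx.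
  exists (d / b); apply: injective_projections => /=; rewrite /GRing.scale /=.
    apply: (mulfI nb); move: h; rewrite a0 mulr0 mul0r sub0r => /eqP.
    by rewrite oppr_eq0 mulr0 => /eqP.
  by rewrite divfK.
exists (c / a); apply: injective_projections => /=; rewrite /GRing.scale /=.
  by rewrite divfK.
by apply: (mulfI na); rewrite mulrA mulrCA divff // mulr1 mulrC; move: h; lra.
Qed.

Lemma lines_meet (R : realType) (l1 l2 : line R) : ~ parallel l1 l2 ->
  exists o, on_line l1 o /\ on_line l2 o.
Proof.
move/cross_neq0; rewrite /on_line.
case: (line_dir l1) (line_dir l2) (line_pt l1) (line_pt l2).
move=> a b [c d] [p p'] [q q'] /= h.
(* Cramer's rule for the two parameters of the meeting point. *)
exists ((p, p') + (((q - p) * d - (q' - p') * c) / (a * d - b * c)) *: (a, b)).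
split; first by eexists.
exists (((q - p) * b - (q' - p') * a) / (a * d - b * c)) => /=.
by apply: injective_projections; rewrite /= /GRing.scale /=; field.
Qed.

Lemma edist_sqr (R : realType) (o d1 d2 : R * R) (s t : R) :
  Defs.edist (o + s *: d1) (o + t *: d2) ^+ 2 =
  quad_form (d1.1 ^+ 2 + d1.2 ^+ 2) (d2.1 ^+ 2 + d2.2 ^+ 2)
    (d1.1 * d2.1 + d1.2 * d2.2) s t.
Proof.
rewrite sqr_sqrtr ?addr_ge0 ?sqr_ge0 // /quad_form /= /GRing.scale /=.
by ring.
Qed.

Lemma sqr_pairs_le_distances (R : realType) (n m : nat) (P1 P2 : {fset R * R})
    (o d1 d2 : R * R) (x : 'I_n -> R) (y : 'I_m -> R) :
  (forall i, o + x i *: d1 \in P1) -> (forall j, o + y j *: d2 \in P2) ->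
  ((n * m) ^ 2 <= num_distances P1 P2 *
    #|coincidences (d1.1 ^+ 2 + d1.2 ^+ 2) (d2.1 ^+ 2 + d2.2 ^+ 2)
        (d1.1 * d2.1 + d1.2 * d2.2) x y|)%N.
Proof.
move=> hx hy.
have hg (t : 'I_n * 'I_m) :
    Defs.edist (o + x t.1 *: d1) (o + y t.2 *: d2) \in distances P1 P2.
  by apply/imfset2P; exists (o + x t.1 *: d1) => //; exists (o + y t.2 *: d2).
pose g t : distances P1 P2 := [` hg t]%fset.
have := card_sqr_fibers g.
rewrite card_prod !card_ord -cardfE => /leq_trans; apply.
rewrite leq_mul2l; apply/orP; right.
(* Regroup two point pairs as a point and a hyperbola. *)
pose f (tt : ('I_n * 'I_m) * ('I_n * 'I_m)) := ((tt.1.1, tt.2.1), (tt.1.2, tt.2.2)).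
rewrite -(@card_imset _ _ f); last by move=> [[? ?] [? ?]] [[? ?] [? ?]] [-> -> -> ->].
apply: subset_leq_card; apply/fintype.subsetP => _ /imsetP[[[i j] [i' j']] + ->].
by rewrite !inE /= => /eqP[] e; rewrite -!(edist_sqr o) e.
Qed.

(** * Choice of the box size and conclusion *)

(** Take [k = floor (mu / n) + 1]. Multiplied by [mu], the three terms are at most 16, 8 and 4 times
    [(n m)^2], whence 28. *)
Lemma optimize_box_size (R : realType) (n m D : nat) (mu : R) :
  (0 < n)%N -> (0 < m)%N -> 0 < mu ->
  mu <= n%:R ^+ 2 -> mu <= m%:R ^+ 2 -> mu ^+ 3 <= n%:R ^+ 2 * m%:R ^+ 2 ->
  (forall k, (0 < k)%N -> ((n * m) ^ 2 <= D *
    (m * m * (8 * (n.-1 %/ k).+1) + 2 * (n * n * (k * k)) + 4 * (n * m)))%N) ->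
  mu <= 28 * D%:R.
Proof.
move=> n0 m0 mu0 mun mum mu3 hk.
have N0 : 0 < n%:R :> R by rewrite ltr0n.
have M0 : 0 < m%:R :> R by rewrite ltr0n.
have q0 : 0 <= mu / n%:R by rewrite divr_ge0 // ltW.
set k := (Num.truncn (mu / n%:R)).+1.
have /andP[k1 k2] := truncn_itv q0.
have kn : (k <= n.+1)%N.
  rewrite ltnS -(ler_nat R); apply: le_trans k1 _.
  by rewrite ler_pdivrMr // -expr2.
(* One block has size at most [n + 1], and the remaining multiple of [k] is at most [n - 1]. *)
have rk : ((n.-1 %/ k).+1 * k <= 2 * n)%N.
  by rewrite mulSn; have := leq_trunc_div n.-1 k; lia.
have {}k2 : mu <= n%:R * k%:R by rewrite mulrC -ler_pdivrMr // ltW.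
have {}k1 : k%:R * n%:R <= mu + n%:R.
  by rewrite /k -natr1 mulrDl mul1r lerD2r -ler_pdivlMr.
(* If [mu < n] then [k = 1] and [mu <= m^2] suffices. Otherwise [k n <= 2 mu], and the bound on
   [mu ^+ 3] applies. *)
have muk : mu * k%:R ^+ 2 <= 4 * m%:R ^+ 2.
  case: (leP n%:R mu) => hmu; last first.
    have : (k < 2)%N.
      by rewrite -(ltr_nat R) -(ltr_pM2r N0); apply: le_lt_trans k1 _; lra.
    rewrite ltnS /k; case: (Num.truncn _) => // _.
    by rewrite expr1n mulr1; have := sqr_ge0 (m%:R : R); lra.
  rewrite -(ler_pM2r (exprn_gt0 2 N0)).
  apply: (@le_trans _ _ (mu * (2 * mu) ^+ 2));
    last by move: mu3; rewrite !expr2 !exprS expr0; nra.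
  rewrite -mulrA -exprMn ler_pM2l // lerXn2r ?nnegrE ?mulr_ge0 ?ler0n //;
    first by rewrite ltW.
  by lra.
have mnm : mu <= n%:R * m%:R.
  rewrite -(@ler_pXn2r _ 2) ?nnegrE ?mulr_ge0 ?ler0n ?(ltW mu0) // exprMn.
  by rewrite (expr2 mu); apply: ler_pM => //; exact: ltW.
have {hk} := hk k isT; rewrite -(ler_nat R) => hk.
have rkR : (n.-1 %/ k).+1%:R * k%:R <= 2 * n%:R :> R by rewrite -!natrM ler_nat.
move: hk; rewrite natrX !(natrM, natrD).
move: rkR; set r : R := (n.-1 %/ k).+1%:R; set K : R := k%:R in k1 k2 muk *.
set N : R := n%:R in N0 k1 k2 mnm mun mu3 *; set M : R := m%:R in M0 mum muk mnm mu3 *.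
set d : R := D%:R => rkR hk.
have r0 : 0 <= r by rewrite ler0n.
have d0 : 0 <= d by rewrite ler0n.
have NM0 : 0 < (N * M) ^+ 2 by rewrite exprn_gt0 // mulr_gt0.
rewrite -(ler_pM2r NM0); apply: le_trans (ler_wpM2l (ltW mu0) hk) _.
rewrite [leRHS](_ : _ = d * (28 * (N * M) ^+ 2)); last by ring.
rewrite mulrCA ler_wpM2l //.
have t1 : mu * (M * M * (8 * r)) <= 16 * (N * M) ^+ 2.
  have : mu * r <= 2 * N * N.
    apply: le_trans (ler_wpM2r r0 k2) _.
    by have := ler_wpM2l (ltW N0) rkR; lra.
  have : 0 <= M * M by rewrite mulr_ge0 // ltW.
  by nra.
have t2 : mu * (2 * (N * N * (K * K))) <= 8 * (N * M) ^+ 2.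
  have : 0 <= N * N by rewrite mulr_ge0 // ltW.
  by move: muk; nra.
have t3 : mu * (4 * (N * M)) <= 4 * (N * M) ^+ 2.
  have : 0 <= N * M by rewrite mulr_ge0 // ltW.
  by nra.
by lra.
Qed.

Theorem theorem1 (R : realType) :
  exists c : R, 0 < c /\
    forall (n m : nat) (P1 P2 : {fset R * R}) (l1 l2 : line R),
      #|` P1| = n -> #|` P2| = m ->
      (forall p, p \in P1 -> on_line l1 p) ->
      (forall q, q \in P2 -> on_line l2 q) ->
      ~ parallel l1 l2 -> ~ orthogonal_lines l1 l2 ->
      c * Num.min (n%:R `^ (2 / 3) * m%:R `^ (2 / 3))
                  (Num.min (n%:R ^+ 2) (m%:R ^+ 2))
        <= (num_distances P1 P2)%:R.
Proof.
exists 28^-1; split=> [|n m P1 P2 l1 l2 hn hm h1 h2 np no]; first by rewrite invr_gt0.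
set mu := Num.min _ _; rewrite mulrC ler_pdivrMr // mulrC.
have mun : mu <= n%:R ^+ 2 by rewrite 2!ge_min lexx orbT.
have mum : mu <= m%:R ^+ 2 by rewrite 2!ge_min lexx !orbT.
(* This settles empty point sets; afterwards [mu > 0] forces [n] and [m] to be positive. *)
have [mu0|mu0] := leP mu 0.
  by apply: le_trans mu0 _; rewrite mulr_ge0.
have pos a : mu <= a%:R ^+ 2 -> (0 < a)%N.
  by case: a => // /(lt_le_trans mu0); rewrite expr0n ltxx.
have mu3 : mu ^+ 3 <= n%:R ^+ 2 * m%:R ^+ 2.
  have cube (a : nat) : (a%:R `^ (2 / 3) : R) ^+ 3 = a%:R ^+ 2.
    rewrite -powR_mulrn ?powR_ge0 // -powRrM -powR_mulrn //.
    by congr (_ `^ _); field.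
  rewrite -!cube -exprMn lerXn2r ?nnegrE ?(ltW mu0) ?mulr_ge0 ?powR_ge0 //.
  by rewrite ge_min lexx.
apply: (@optimize_box_size R n m) => //; [exact: pos | exact: pos | move=> k k0].
have [z [z1 z2]] := lines_meet np.
have [x [xm xP]] := sorted_line_coordinates z1 h1.
have [y [ym yP]] := sorted_line_coordinates z2 h2.
subst n m.
apply: leq_trans (sqr_pairs_le_distances xP yP) _.
rewrite leq_mul2l; apply/orP; right.
have nz12 := cross_neq0 np.
have dir0 (l : line R) : 0 < (line_dir l).1 ^+ 2 + (line_dir l).2 ^+ 2.
  move: (line_dir_neq0 l); case: (line_dir l) => a b /= nz.
  rewrite lt_def addr_ge0 ?sqr_ge0 ?andbT //.
  by rewrite paddr_eq0 ?sqr_ge0 // !sqrf_eq0 -xpair_eqE.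
apply: card_coincidences => //.
- exact/eqP.
(* Lagrange's identity: [A B - C^2] is the square of the cross product of the directions. *)
- rewrite -subr_gt0; have : 0 < ((line_dir l1).1 * (line_dir l2).2 -
    (line_dir l1).2 * (line_dir l2).1) ^+ 2 by rewrite lt_def sqrf_eq0 nz12 sqr_ge0.
  by congr (0 < _); ring.
- move=> i j e; apply: val_inj => /=.
  by case: (ltngtP i j) => // /ym; rewrite e ltxx.
Qed.
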